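(* Let $f:A\to B$ and $p:B\to C$ be continuous maps of T$_1$-spaces, and regard $f$ as a morphism $f:q\to p$ in the slice category $\mathsf{Top}_1/C$, where $q=p\cdot f$. Then the normal closure of $f$ in $\mathsf{Top}_1/C$ may be computed as the subspace inclusion $$\nu_{f/C}:\; N_{f/C}=\bigcup_{a\in A}\overline{f(q^{-1}(qa))}\;\hookrightarrow\; B,$$ where the closures are taken in $B$. The morphism $f:q\to p$ is a normal monomorphism in $\mathsf{Top}_1/C$ if, and only if, $f$ is an embedding such that, for every $a\in A$, the set $f(q^{-1}(qa))$ is closed in $B$. The class $\mathsf{NMono}(\mathsf{Top}_1/C)$ of normal monomorphisms of $\mathsf{Top}_1/C$ is closed under composition.
   Context: $\mathsf{Top}_1$ is the category of T$_1$-spaces and continuous maps. For an object $C$ of a category $\mathbb{C}$, the slice $\mathbb{C}/C$ has as objects the morphisms of $\mathbb{C}$ with codomain $C$; a morphism $f:q\to p$ is a morphism $f$ of $\mathbb{C}$ with $p\cdot f=q$. In a finitely complete and finitely cocomplete category with terminal object $1$, the normal closure of a morphism $f:A\to B$ is the pullback projection $\nu_f:N_f=B\times_{(B+_A1)}1\to B$, where $B+_A1$ is the pushout of $f$ along $A\to1$ and the pullback is formed of the two pushout injections $B\to B+_A1\leftarrow 1$; it is determined up to isomorphism over $B$. With $\hat f:A\to N_f$ the induced morphism satisfying $\nu_f\cdot\hat f=f$, $f$ is called a normal monomorphism if $\hat f$ is an isomorphism. Applied in the slice $\mathbb{C}/C$ (with terminal object $1_C$) to $f:q\to p$ with $f:A\to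 B$, $p:B\to C$, $q=p\cdot f$ in $\mathbb{C}$, this amounts to forming in $\mathbb{C}$ the pushout $B+_AC$ of $f$ along $q$ and then the pullback $N_{f/C}$ of the pushout injections $B\to B+_AC\leftarrow C$; its projection $N_{f/C}\to B$ is (the underlying morphism of) the normal closure $\nu_{f/C}$ of $f$ in $\mathbb{C}/C$. *)

(* Defs.v *)
From HB Require Import structures.
From mathcomp Require Import all_boot all_classical.
From mathcomp Require Import topology.

Set Implicit Arguments.
Unset Strict Implicit.
Unset Printing Implicit Defensive.

Local Open Scope classical_set_scope.

(** * Categories and slices *)

Record category := Category {
  obj :> Type;
  hom : obj -> obj -> Type;
  idm : forall X, hom X X;
  comp : forall X Y Z, hom Y Z -> hom X Y -> hom X Z;
  comp1m : forall X Y (f : hom X Y), comp (idm Y) f = f;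
  compm1 : forall X Y (f : hom X Y), comp f (idm X) = f;
  compA : forall W X Y Z (h : hom Y Z) (g : hom X Y) (f : hom W X),
    comp h (comp g f) = comp (comp h g) f
}.

Arguments hom {_} _ _.
Arguments idm {_} _.
Arguments comp {_ _ _ _} _ _.
Notation "g \* f" := (comp g f) (at level 40, left associativity).

Section Slice.
Context (K : category) (C : K).

Record slice_obj := SliceObj { slice_dom : K; slice_arr : hom slice_dom C }.

Definition slice_hom (q p : slice_obj) :=
  {f : hom (slice_dom q) (slice_dom p) | slice_arr p \* f = slice_arr q}.

Lemma slice_hom_eq (q p : slice_obj) (f g : slice_hom q p) :
  sval f = sval g -> f = g.
Proof. exact: eq_sig_hprop. Qed.

Lemma slice_id_subproof (p : slice_obj) :
  slice_arr p \* idm (slice_dom p) = slice_arr p.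
Proof. exact: compm1. Qed.

Lemma slice_comp_subproof (r q p : slice_obj)
    (g : slice_hom q p) (f : slice_hom r q) :
  slice_arr p \* (sval g \* sval f) = slice_arr r.
Proof. by rewrite compA (svalP g) (svalP f). Qed.

Definition slice_idm (p : slice_obj) : slice_hom p p :=
  exist _ _ (slice_id_subproof p).

Definition slice_comp (r q p : slice_obj)
    (g : slice_hom q p) (f : slice_hom r q) : slice_hom r p :=
  exist _ _ (slice_comp_subproof g f).

Lemma slice_comp1m (q p : slice_obj) (f : slice_hom q p) :
  slice_comp (slice_idm p) f = f.
Proof. exact/slice_hom_eq/comp1m. Qed.

Lemma slice_compm1 (q p : slice_obj) (f : slice_hom q p) :
  slice_comp f (slice_idm q) = f.
Proof. exact/slice_hom_eq/compm1. Qed.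

Lemma slice_compA (s r q p : slice_obj) (h : slice_hom q p)
    (g : slice_hom r q) (f : slice_hom s r) :
  slice_comp h (slice_comp g f) = slice_comp (slice_comp h g) f.
Proof. exact/slice_hom_eq/compA. Qed.

Definition slice : category := {|
  obj := slice_obj;
  hom := slice_hom;
  idm := slice_idm;
  comp := slice_comp;
  comp1m := slice_comp1m;
  compm1 := slice_compm1;
  compA := slice_compA
|}.

(** [f : A -> B] as a morphism from [p \* f] to [p] in the slice over [C]. *)
Definition slice_mor (A B : K) (f : hom A B) (p : hom B C) :
    @hom slice (SliceObj (p \* f)) (SliceObj p) :=
  exist _ f erefl.

End Slice.

Arguments slice K C : clear implicits.
Arguments slice_mor {K C A B} f p.
Arguments SliceObj {K C slice_dom} slice_arr.

(** * Normal closures and normal monomorphisms *)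

Section Normal.
Context {K : category}.

Definition is_terminal (T : K) : Prop :=
  forall X : K, exists! h : hom X T, True.

Definition is_iso (X Y : K) (f : hom X Y) : Prop :=
  exists2 g : hom Y X, g \* f = idm X & f \* g = idm Y.

Definition is_pushout (A B D P : K)
    (f : hom A B) (g : hom A D) (i : hom B P) (j : hom D P) : Prop :=
  i \* f = j \* g /\
  forall (X : K) (u : hom B X) (v : hom D X), u \* f = v \* g ->
    exists! h : hom P X, h \* i = u /\ h \* j = v.

Definition is_pullback (N B D P : K)
    (u : hom N B) (v : hom N D) (i : hom B P) (j : hom D P) : Prop :=
  i \* u = j \* v /\
  forall (X : K) (x : hom X B) (y : hom X D), i \* x = j \* y ->
    exists! h : hom X N, u \* h = x /\ v \* h = y.

(** Here [P] is the pushout [B +_A 1] and [N] the pullback [B x_P 1].  These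
    are given only up to isomorphism, so "being a normal closure of [f]" is a
    property of [nu], which includes the existence of [1] and [P]. *)
Definition is_normal_closure (A B N : K) (f : hom A B) (nu : hom N B) : Prop :=
  exists (one P : K) (tA : hom A one) (tN : hom N one)
         (i : hom B P) (j : hom one P),
    [/\ is_terminal one, is_pushout f tA i j & is_pullback nu tN i j].

(** Both projections of the pullback are prescribed on [fhat] (the one to [1]
    trivially), so [fhat] is the induced morphism. *)
Definition is_normal_mono (A B : K) (f : hom A B) : Prop :=
  exists (N : K) (nu : hom N B) (fhat : hom A N),
    [/\ is_normal_closure f nu, nu \* fhat = f & is_iso fhat].

End Normal.

Definition morphism_class (K : category) := forall X Y : K, hom X Y -> Prop.

Definition NMono (K : category) : morphism_class K := @is_normal_mono K.

Arguments NMono : clear implicits.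

Definition closed_under_composition (K : category) (M : morphism_class K) :=
  forall (X Y Z : K) (f : hom X Y) (g : hom Y Z),
    M X Y f -> M Y Z g -> M X Z (g \* f).

(** * The category of T1-spaces *)

Record t1space := T1Space {
  t1_sort :> topologicalType;
  t1_accessible : accessible_space t1_sort
}.

Definition t1_id (X : t1space) : continuousType X X := idfun.

Definition t1_comp (X Y Z : t1space)
    (g : continuousType Y Z) (f : continuousType X Y) : continuousType X Z :=
  g \o f.

Lemma t1_comp1m (X Y : t1space) (f : continuousType X Y) :
  t1_comp (t1_id Y) f = f.
Proof. exact/continuousEP. Qed.

Lemma t1_compm1 (X Y : t1space) (f : continuousType X Y) :
  t1_comp f (t1_id X) = f.
Proof. exact/continuousEP. Qed.

Lemma t1_compA (W X Y Z : t1space) (h : continuousType Y Z)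
    (g : continuousType X Y) (f : continuousType W X) :
  t1_comp h (t1_comp g f) = t1_comp (t1_comp h g) f.
Proof. exact/continuousEP. Qed.

Definition Top1 : category := {|
  obj := t1space;
  hom := fun X Y => continuousType X Y;
  idm := t1_id;
  comp := t1_comp;
  comp1m := t1_comp1m;
  compm1 := t1_compm1;
  compA := t1_compA
|}.

Section Subspace.
Context (X : t1space) (S : set X).

Lemma subspace_accessible : accessible_space (set_type S).
Proof.
move=> x y xy; have : set_val x != set_val y by [].
move=> /t1_accessible[U [oU xU yU]]; exists (set_val @^-1` U); split.
- by exists U.
- by move: xU; rewrite !inE.
- by move: yU; rewrite !inE.
Qed.

(** [set_type S] carries the initial topology of its inclusion in [X]. *)
Definition t1_subspace : t1space := T1Space subspace_accessible.

Lemma subspace_incl_continuous : continuous (set_val : set_type S -> X).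
Proof. exact: initial_continuous. Qed.

Definition subspace_incl : continuousType t1_subspace X :=
  mkcts subspace_incl_continuous.

End Subspace.

Arguments subspace_incl {X} S.

Definition is_embedding (X Y : topologicalType) (f : X -> Y) : Prop :=
  injective f /\
  forall U : set X, open U <-> exists2 V : set Y, open V & f @^-1` V = U.

Section Fibres.
Context (A B C : t1space) (f : continuousType A B) (p : continuousType B C).

Definition fibre_image (a : A) : set B :=
  f @` ((p \o f) @^-1` [set (p \o f) a]).

Definition normal_closure_set : set B := \bigcup_a closure (fibre_image a).

End Fibres.

(* Main.v *)
Require Import Defs.
From HB Require Import structures.
From mathcomp Require Import all_boot all_classical.
From mathcomp Require Import topology.

(** Write [N] for the union of the closures of the sets [f(q^-1(q a))].  Each of
    these closures lies in a single fibre of [p], so [N] meets every fibre of [p]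
    in a closed set; gluing each point [b] of [N] to [p b] therefore yields a T1
    quotient of [B + C].  As maps to T1-spaces cannot separate a closure
    from a point to which the set is mapped, this quotient is the pushout, and
    [b] is glued to [p b] exactly when [b] is in [N].  Since normal closures are
    unique up to isomorphism, [f] is normal iff it corestricts to a homeomorphism
    onto [N]; the topological description this gives is stable under
    composition. *)

Set Implicit Arguments.
Unset Strict Implicit.
Unset Printing Implicit Defensive.

Local Open Scope classical_set_scope.

(** * Uniqueness of normal closures in an arbitrary category *)

Section NormalClosureUnique.
Context {K : category}.

Lemma terminal_unique (T X : K) (h k : hom X T) : is_terminal T -> h = k.
Proof. by move=> /(_ X)[l [_ lP]]; rewrite -(lP h I) -(lP k I). Qed.

(** Pullback projections are jointly monic, and the one to the terminal object cannot separate
    maps. *)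
Lemma normal_closure_mono (A B N X : K) (f : hom A B) (nu : hom N B)
    (h k : hom X N) :
  is_normal_closure f nu -> nu \* h = nu \* k -> h = k.
Proof.
move=> [T [P [tA [tN [i [j [termT _ [sq pb]]]]]]]] hk.
have [l [_ lP]] : exists! l, nu \* l = nu \* k /\ tN \* l = tN \* k.
  by apply: pb; rewrite !Defs.compA sq.
by rewrite -(lP h) ?(lP k) //; split=> //; exact: terminal_unique.
Qed.

Lemma normal_closure_le (A B N N' : K) (f : hom A B)
    (nu : hom N B) (nu' : hom N' B) :
  is_normal_closure f nu -> is_normal_closure f nu' ->
  exists k : hom N N', nu' \* k = nu.
Proof.
move=> [T [P [tA [tN [i [j [termT [fi po] [sq _]]]]]]]].
move=> [T' [P' [tA' [tN' [i' [j' [termT' [fi' _] [_ pb']]]]]]]].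
have [t _] := termT' T.
(* Comparing the terminal objects by [t] makes [P'] a cocone on the first span. The resulting [h]
   carries the first square to a cone over the second cospan. *)
have [|h [[hi hj] _]] := po _ i' (j' \* t).
  by rewrite fi' -Defs.compA; congr (_ \* _); exact: terminal_unique.
have [|k [[nuk _] _]] := pb' _ nu (t \* tN); last by exists k.
by rewrite -hi -Defs.compA sq !Defs.compA hj.
Qed.

Lemma normal_closure_iso (A B N N' : K) (f : hom A B)
    (nu : hom N B) (nu' : hom N' B) :
  is_normal_closure f nu -> is_normal_closure f nu' ->
  exists2 k : hom N N', nu' \* k = nu & is_iso k.
Proof.
move=> ncN ncN'; have [k kP] := normal_closure_le ncN ncN'.
have [k' k'P] := normal_closure_le ncN' ncN.
exists k => //; exists k'.
- by apply: (normal_closure_mono ncN); rewrite Defs.compA k'P kP compm1.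
- by apply: (normal_closure_mono ncN'); rewrite Defs.compA kP k'P compm1.
Qed.

Lemma iso_comp (X Y Z : K) (g : hom Y Z) (f : hom X Y) :
  is_iso g -> is_iso f -> is_iso (g \* f).
Proof.
move=> [g' g'g gg'] [f' f'f ff']; exists (f' \* g').
- by rewrite -Defs.compA (Defs.compA g') g'g comp1m.
- by rewrite -Defs.compA (Defs.compA f) ff' comp1m.
Qed.

(** Normality asks for some normal closure; by uniqueness, any given one decides it. *)
Lemma normal_monoP (A B N : K) (f : hom A B) (nu : hom N B) :
  is_normal_closure f nu ->
  is_normal_mono f <-> exists2 e : hom A N, nu \* e = f & is_iso e.
Proof.
move=> ncN; split=> [[N' [nu' [e [ncN' eP isoe]]]]|[e eP isoe]].
- have [k kP isok] := normal_closure_iso ncN' ncN.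
  by exists (k \* e); [rewrite Defs.compA kP|exact: iso_comp].
- by exists N, nu, e.
Qed.

End NormalClosureUnique.

(** * The T1 quotient of [B + C] gluing [N] along [p] *)

Section Collapse.
Context {B C : t1space} (p : continuousType B C) (N : set B).

(** [B +_N C] as a set: a point of [N] is represented by its image in [C].  The
    vacuous [let] makes the type depend on [p], hence so can its topology. *)
Definition collapse : Type :=
  let _ := p in set_type [set x : B + C | if x is inl b then ~ N b else True].

HB.instance Definition _ := Choice.on collapse.

Definition collapse_base (c : C) : collapse := SigSub (mem_set (I : _ (inr c))).

Definition collapse_map (b : B) : collapse :=
  match pselect (N b) with
  | left _ => collapse_base (p b)
  | right nb => SigSub (mem_set (nb : _ (inl b)))
  end.

(** Total without any compatibility of [u] and [v]: glued points are read through [v] alone. *)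
Definition collapse_rec (X : Type) (u : B -> X) (v : C -> X) (z : collapse) : X :=
  match val z with inl b => u b | inr c => v c end.

Lemma collapse_map_in b : N b -> collapse_map b = collapse_base (p b).
Proof. by rewrite /collapse_map; case: pselect. Qed.

Lemma collapse_mapP b :
  (N b /\ collapse_map b = collapse_base (p b)) \/
  (~ N b /\ val (collapse_map b) = inl b).
Proof. by rewrite /collapse_map; case: pselect; [left|right]. Qed.

Lemma collapseP (z : collapse) :
  (exists2 b, ~ N b & z = collapse_map b) \/ (exists c, z = collapse_base c).
Proof.
case: z => -[b|c] zP; [left; exists b|right; exists c]; last exact: val_inj.
  by have := set_mem zP.
by apply: val_inj; have [[/(set_mem zP)//]|[_ ->]] := collapse_mapP b.
Qed.

Lemma collapse_rec_map X (u : B -> X) (v : C -> X) :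
  (forall b, N b -> u b = v (p b)) ->
  forall b, collapse_rec u v (collapse_map b) = u b.
Proof.
move=> uv b; have [[Nb ->]|[_ e]] := collapse_mapP b; first by rewrite uv.
by rewrite /collapse_rec e.
Qed.

Lemma collapse_eq X (h k : collapse -> X) :
  h \o collapse_map =1 k \o collapse_map ->
  h \o collapse_base =1 k \o collapse_base -> h =1 k.
Proof.
by move=> hB hC z; have [[b _ ->]|[c ->]] := collapseP z; [exact: hB|exact: hC].
Qed.

(** The final topology for the two maps, that is, the quotient topology from [B + C]. *)
Definition collapse_open : set_system collapse :=
  [set U | open (collapse_map @^-1` U) /\ open (collapse_base @^-1` U)].

Fact collapse_openT : collapse_open setT.
Proof. by split; exact: openT. Qed.

Fact collapse_openI : setI_closed collapse_open.
Proof. by move=> U V [? ?] [? ?]; split; exact: openI. Qed.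

Fact collapse_open_bigU (I : Type) (F : I -> set collapse) :
  (forall i, collapse_open (F i)) -> collapse_open (\bigcup_i F i).
Proof.
by move=> Fo; split; rewrite preimage_bigcup; apply: bigcup_open => i _;
  have [] := Fo i.
Qed.

HB.instance Definition _ := isOpenTopological.Build collapse
  collapse_openT collapse_openI collapse_open_bigU.

Lemma collapse_map_continuous : continuous collapse_map.
Proof. by apply/continuousP => U []. Qed.

Lemma collapse_base_continuous : continuous collapse_base.
Proof. by apply/continuousP => U []. Qed.

Lemma collapse_continuous (X : topologicalType) (h : collapse -> X) :
  continuous (h \o collapse_map) -> continuous (h \o collapse_base) ->
  continuous h.
Proof.
move=> /continuousP hB /continuousP hC; apply/continuousP => U oU.
by split; [exact: hB|exact: hC].
Qed.

Lemma collapse_rec_continuous (X : topologicalType) (u : B -> X) (v : C -> X) :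
  (forall b, N b -> u b = v (p b)) -> continuous u -> continuous v ->
  continuous (collapse_rec u v).
Proof.
move=> uv cu cv; apply: collapse_continuous.
- by rewrite (_ : _ \o _ = u)//; apply/funext/collapse_rec_map.
- by rewrite (_ : _ \o _ = v).
Qed.

Hypothesis closedN : forall c, closed (N `&` p @^-1` [set c]).

Lemma collapse_closed1 (z : collapse) : closed [set z].
Proof.
rewrite -openC; split; rewrite -preimage_setC openC.
- have [[b nNb ->]|[c ->]] := collapseP z.
  + rewrite (_ : _ @^-1` _ = [set b]).
      exact/accessible_closed_set1/t1_accessible.
    apply/seteqP; split=> [b'|_ ->//] /= /(congr1 val).
    have [[//]|[_ ->]] := collapse_mapP b.
    by have [[_ ->//]|[_ ->] []] := collapse_mapP b'.
  (* The preimage in [B] of a base point is a fibre of [N] over [C], closed by [closedN]. *)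
  + rewrite (_ : _ @^-1` _ = N `&` p @^-1` [set c])//.
    apply/seteqP; split=> [b|b [Nb <-]] /=; last by rewrite collapse_map_in.
    have [[Nb ->] /(congr1 val)[]//|[_ e] /(congr1 val)] := collapse_mapP b.
    by rewrite e.
- have [[b nNb ->]|[c ->]] := collapseP z.
  + rewrite (_ : _ @^-1` _ = set0); first exact: closed0.
    apply/seteqP; split=> [c|//] /= /(congr1 val).
    by have [[//]|[_ ->]] := collapse_mapP b.
  + rewrite (_ : _ @^-1` _ = [set c]).
      exact/accessible_closed_set1/t1_accessible.
    by apply/seteqP; split=> [c'|_ ->//] /= /(congr1 val)[].
Qed.

Lemma collapse_accessible : accessible_space collapse.
Proof.
move=> x y xy; exists (~` [set y]); rewrite !inE /=; split.
- by rewrite openC; exact: collapse_closed1.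
- exact/eqP.
- by [].
Qed.

Definition t1_collapse : t1space := T1Space collapse_accessible.

End Collapse.

(** * Closures of fibre images *)

Section FibreImages.
Context (A B C : t1space) (f : continuousType A B) (p : continuousType B C).

Lemma closure_preimage1 (X Y : t1space) (u : continuousType X Y) y (D : set X) :
  D `<=` u @^-1` [set y] -> closure D `<=` u @^-1` [set y].
Proof.
move=> Dy; have /closure_id -> : closed (u @^-1` [set y]).
  apply: preimage_closed; last exact/accessible_closed_set1/t1_accessible.
  by move=> x _; exact: cts_fun.
exact: closureS.
Qed.

Lemma closure_fibre_image a b :
  closure (fibre_image f p a) b -> p b = p (f a).
Proof. by apply: closure_preimage1 => _ [a' + <-]. Qed.

Lemma eq_fibre_image a a' :
  p (f a) = p (f a') -> fibre_image f p a = fibre_image f p a'.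
Proof. by move=> paa'; rewrite /fibre_image /= paa'. Qed.

Lemma fibre_image_self a : fibre_image f p a (f a).
Proof. by exists a. Qed.

Lemma normal_closure_set_im a : normal_closure_set f p (f a).
Proof. by exists a => //; apply/subset_closure/fibre_image_self. Qed.

(** The union itself may fail to be closed, but over each [c] it reduces to at most one closure, as
    [fibre_image f p a] depends only on [p (f a)]. *)
Lemma normal_closure_set_fibre c :
  closed (normal_closure_set f p `&` p @^-1` [set c]).
Proof.
have [[a <-]|nc] := pselect (exists a, p (f a) = c).
  rewrite (_ : _ `&` _ = closure (fibre_image f p a)); first exact: closed_closure.
  apply/seteqP; split=> [b [[a' _ ba'] /= pb]|b ba]; last first.
    by split; [exists a|exact: closure_fibre_image].
  by rewrite -(@eq_fibre_image a')// -(closure_fibre_image ba').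
rewrite (_ : _ `&` _ = set0); first exact: closed0.
apply/seteqP; split=> // b [[a _ ba] /= pb]; apply: nc; exists a.
by rewrite -pb (closure_fibre_image ba).
Qed.

(* A T1 point cannot tell [fibre_image f p a] from its closure, which is why
   any cocone under [f] and [p \o f] also identifies all of [N]. *)
Lemma normal_closure_set_cocone (X : t1space) (u : continuousType B X)
    (v : continuousType C X) :
  (forall a, u (f a) = v (p (f a))) ->
  forall b, normal_closure_set f p b -> u b = v (p b).
Proof.
move=> uv b [a _ ba]; rewrite (closure_fibre_image ba).
by apply: closure_preimage1 ba => _ [a' /= pa' <-]; rewrite /= uv pa'.
Qed.

End FibreImages.

(** * Normal closures in the slice of T1-spaces *)

Section SliceTop.
Context {C : t1space}.
Notation Top1C := (slice Top1 C).

Lemma slice_top_eqP (q p : Top1C) (f g : hom q p) :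
  f = g <-> sval f =1 sval g.
Proof.
split=> [->//|fg]; apply: slice_hom_eq; exact/continuousEP.
Qed.

Lemma slice_homE (q p : Top1C) (f : hom q p) x :
  slice_arr p (sval f x) = slice_arr q x.
Proof. by have /continuousEP := svalP f; exact. Qed.

(** Kept transparent so that [sval] of the result reduces to [u]. *)
Definition slice_top_mor (X Y : t1space) (x : continuousType X C)
    (y : continuousType Y C) (u : continuousType X Y)
    (xy : forall z, y (u z) = x z) :
  @hom Top1C (@SliceObj Top1 C X x) (@SliceObj Top1 C Y y).
Proof. exists u; exact/continuousEP. Defined.

Definition slice_one : Top1C := @SliceObj Top1 C C (t1_id C).

Definition slice_to_one (q : Top1C) : hom q slice_one :=
  @slice_top_mor _ C (slice_arr q) (t1_id C) (slice_arr q) (fun=> erefl).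

Lemma slice_one_terminal : is_terminal slice_one.
Proof.
move=> q; exists (slice_to_one q); split=> // h _.
by apply/slice_top_eqP => x; rewrite -(slice_homE h).
Qed.

Section NormalClosure.
Context (A B : t1space) (f : continuousType A B) (p : continuousType B C).
Let N := normal_closure_set f p.
Let P : t1space := t1_collapse (@normal_closure_set_fibre _ _ _ f p).

Let i0 : continuousType B P := mkcts (@collapse_map_continuous _ _ p N).
Let j0 : continuousType C P := mkcts (@collapse_base_continuous _ _ p N).

(** [p] on [B] and the identity on [C] agree on glued points, which makes the quotient an object
    over [C]. *)
Fact collapse_arr_subproof : continuous (@collapse_rec _ _ p N C p idfun).
Proof. by apply: (collapse_rec_continuous (p := p)) => // x; exact: cts_fun. Qed.

Let r : continuousType P C := mkcts collapse_arr_subproof.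

Lemma collapse_arr_map b : r (i0 b) = p b.
Proof. exact: collapse_rec_map. Qed.

Let i : @hom Top1C (@SliceObj Top1 C B p) (@SliceObj Top1 C P r) :=
  slice_top_mor collapse_arr_map.
Let j : @hom Top1C slice_one (@SliceObj Top1 C P r) :=
  @slice_top_mor _ _ (t1_id C) r j0 (fun=> erefl).

Lemma collapse_pushout :
  is_pushout (slice_mor (K := Top1) f p) (slice_to_one _) i j.
Proof.
split=> [|X u v uv].
  apply/slice_top_eqP => a /=; apply: collapse_map_in.
  exact: normal_closure_set_im.
have {}uv a : sval u (f a) = sval v (p (f a)) by move/slice_top_eqP: uv; exact.
have {}uv := normal_closure_set_cocone uv.
have hc := collapse_rec_continuous uv (@cts_fun _ _ (sval u)) (@cts_fun _ _ (sval v)).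
pose h : continuousType P (slice_dom X) := mkcts hc.
have hr : forall z, slice_arr X (h z) = r z.
  apply: collapse_eq => [b|c] /=.
    by rewrite collapse_arr_map /h /mkcts collapse_rec_map// (slice_homE u).
  exact: (slice_homE v).
exists (@slice_top_mor _ _ r (slice_arr X) h hr); split.
  by split; apply/slice_top_eqP => // b; exact: collapse_rec_map.
move=> h' [/slice_top_eqP hi /slice_top_eqP hj].
apply/slice_top_eqP; apply: collapse_eq => [b|c] /=.
  by rewrite -[RHS]/(sval (h' \* i) b) hi; exact: collapse_rec_map.
by rewrite -[RHS]/(sval (h' \* j) c) hj.
Qed.

(** Outside [N] a point keeps its [inl] representative, so it never meets the base; [r] recovers
    [c]. *)
Lemma collapse_eqP b c : i0 b = j0 c -> N b /\ p b = c.
Proof.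
move=> ij; split; last by have := congr1 r ij; rewrite collapse_arr_map.
have [[]//|[_ e]] := collapse_mapP p N b.
by move/(congr1 val): ij; rewrite /= [LHS]e.
Qed.

(** A cone over the cospan has its [B]-component valued in [N], so it corestricts to the subspace,
    continuously for the initial topology. *)
Lemma slice_normal_closure :
  is_normal_closure (slice_mor (K := Top1) f p)
    (slice_mor (K := Top1) (subspace_incl N) p).
Proof.
exists slice_one, (@SliceObj Top1 C P r), (slice_to_one _), (slice_to_one _), i, j.
split; [exact: slice_one_terminal|exact: collapse_pushout|].
split=> [|X x y /slice_top_eqP ixjy].
  by apply/slice_top_eqP => -[b bN]; apply: collapse_map_in; exact: set_mem.
have xN z : N (sval x z) by have [] := collapse_eqP (ixjy z).
pose h0 (z : slice_dom X) : t1_subspace N := SigSub (mem_set (xN z)).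
have h0c : continuous h0 by apply: continuous_comp_initial; exact: cts_fun.
pose h : continuousType (slice_dom X) (t1_subspace N) := mkcts h0c.
have hp z : (p \o subspace_incl N) (h z) = slice_arr X z.
  exact: (slice_homE x).
exists (@slice_top_mor _ _ (slice_arr X) (p \o subspace_incl N) h hp); split.
  split; first exact/slice_top_eqP.
  exact/terminal_unique/slice_one_terminal.
move=> k [/slice_top_eqP kx _]; apply/slice_top_eqP => z.
by apply: val_inj; exact: esym (kx z).
Qed.

End NormalClosure.

(** Normality is tested on the inclusion of [N]: it says that [f] corestricts to a homeomorphism
    onto [N]. *)
Lemma slice_normal_monoP (q p : Top1C) (f : hom q p) :
  is_normal_mono f <->
  is_embedding (sval f) /\ forall a, closed (fibre_image (sval f) (slice_arr p) a).
Proof.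
(* Eliminating [fq] turns [q] into the composite of [p] and [f], so that [f] becomes a
   [slice_mor]. *)
case: q p f => A q [B p] [f /= fq]; case: _ / fq.
rewrite (normal_monoP (slice_normal_closure f p)).
set N := normal_closure_set f p.
split=> [[e /slice_top_eqP /= ef [e' /slice_top_eqP /= e'e /slice_top_eqP /= ee']]|
         [[finj fopen] fcl]].
  have {}ef a : \val (sval e a) = f a := ef a.
  have {}e'e a : sval e' (sval e a) = a := e'e a.
  have {}ee' b : sval e (sval e' b) = b := ee' b.
  split.
    split=> [a a' faa'|U].
      by rewrite -[a]e'e -[a']e'e; congr (sval e' _); apply: val_inj; rewrite !ef.
    split=> [oU|[V oV <-]]; last by apply: open_comp => // x _; exact: cts_fun.
    have /continuousP/(_ U oU)[V oV VU] := @cts_fun _ _ (sval e').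
    exists V => //; rewrite -(_ : sval e @^-1` (sval e' @^-1` U) = U); last first.
      by apply/funext => a /=; rewrite e'e.
    by rewrite -VU; apply/funext => a /=; rewrite -ef.
  move=> a; apply/closure_id/seteqP; split; first exact: subset_closure.
  (* A point of the closure lies in [N], so [e'] gives it a preimage under [f], in the right fibre
     because the closure stays over [p (f a)]. *)
  move=> b ba; have Nb : N b by exists a.
  have fb : f (sval e' (SigSub (mem_set Nb))) = b by rewrite -ef ee'.
  by eexists; last exact: fb; rewrite /= fb (closure_fibre_image ba).
have im b : N b -> exists a, f a = b.
  by move=> [a _]; rewrite -((closure_id _).1 (fcl a)) => -[a' _ <-]; exists a'.
have imN (b : t1_subspace N) : {a | f a = set_val b}.
  exact/cid/im/(set_mem (valP b)).
pose h (b : t1_subspace N) : A := sval (imN b).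
have fh b : f (h b) = set_val b := svalP (imN b).
have hc : continuous h.
  (* If [U] is the preimage of [V] under [f], its preimage under [h] is the trace of [V] on [N]. *)
  apply/continuousP => U /fopen[V oV <-]; exists V => //.
  by apply/funext => b /=; rewrite fh.
pose h0 (a : A) : t1_subspace N := SigSub (mem_set (normal_closure_set_im f p a)).
have h0c : continuous h0 by apply: continuous_comp_initial; exact: cts_fun.
pose e : continuousType A (t1_subspace N) := mkcts h0c.
pose e' : continuousType (t1_subspace N) A := mkcts hc.
have pe a : (p \o subspace_incl N) (e a) = (p \o f) a by [].
have pe' b : (p \o f) (e' b) = (p \o subspace_incl N) b by rewrite /= [f _]fh.
exists (@slice_top_mor _ _ (p \o f) (p \o subspace_incl N) e pe).
  exact/slice_top_eqP.
exists (@slice_top_mor _ _ (p \o subspace_incl N) (p \o f) e' pe').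
  by apply/slice_top_eqP => a; apply: finj; exact: fh.
by apply/slice_top_eqP => b; apply: val_inj; exact: fh.
Qed.

(** * Composition of normal monomorphisms *)

Lemma embedding_comp (X Y Z : topologicalType) (g : Y -> Z) (f : X -> Y) :
  is_embedding g -> is_embedding f -> is_embedding (g \o f).
Proof.
move=> [ginj gopen] [finj fopen]; split; first exact: inj_comp.
move=> U; rewrite fopen; split=> [[V /gopen[W oW <-] <-]|[W oW <-]].
  by exists W.
by exists (g @^-1` W) => //; apply/gopen; exists W.
Qed.

Lemma embedding_closed (X Y : topologicalType) (f : X -> Y) (D : set X) :
  is_embedding f -> closed D -> exists2 V, closed V & f @^-1` V = D.
Proof.
move=> [_ fopen]; rewrite -openC => /fopen[V oV VD].
exists (~` V); first by rewrite closedC.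
by rewrite -preimage_setC VD setCK.
Qed.

Lemma slice_normal_mono_comp : closed_under_composition (NMono Top1C).
Proof.
move=> X Y Z f g /slice_normal_monoP[ef cf] /slice_normal_monoP[eg cg].
apply/slice_normal_monoP; split; first exact: embedding_comp.
move=> a.
(* As [g] is an embedding, a closed [V] pulls back along it to the fibre image of [f]. Then [V] cuts
   the fibre image of the composite out of that of [g]. *)
have [V cV VF] := embedding_closed eg (cf a).
rewrite (_ : fibre_image _ _ a =
  V `&` fibre_image (sval g) (slice_arr Z) (sval f a)).
  by apply: closedI.
apply/seteqP; split=> [_ [a' /= aa' <-]|z [+ [y /= ya yz]]].
  split; last by exists (sval f a').
  rewrite -[V _]/((sval g @^-1` V) (sval f a')) VF; exists a' => //=.
  by rewrite -!(slice_homE g).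
rewrite -yz -[V _]/((sval g @^-1` V) y) VF => -[a' /= aa' <-]; exists a' => //=.
by rewrite !(slice_homE g).
Qed.

End SliceTop.

Theorem theorem7p4 (C : t1space) :
  (forall (A B : t1space) (f : continuousType A B) (p : continuousType B C),
     is_normal_closure
       (slice_mor (K := Top1) (C := C) f p)
       (slice_mor (K := Top1) (C := C)
          (subspace_incl (normal_closure_set f p)) p)
     /\
     (is_normal_mono (slice_mor (K := Top1) (C := C) f p) <->
      is_embedding f /\ forall a : A, closed (fibre_image f p a)))
  /\
  closed_under_composition (NMono (slice Top1 C)).
Proof.
split=> [A B f p|]; last exact: slice_normal_mono_comp.
split; [exact: slice_normal_closure|exact: slice_normal_monoP].
Qed.
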